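(* Let $\gamma>2$. There exists a constant $B_\gamma>0$ depending only on $\gamma$ such that the following holds for all $m,R>0$ and all admissible $u_0$, i.e. $u_0\in C^2([0,m])$ with $\min_{[0,m]}u_0'>0$, $u_0(0)=-R$, $u_0(m)=R$. Let $f_0$ be the density on $[-R,R]$ given by $f_0(u_0(x))=1/u_0'(x)$, let $u$ be the viscosity solution of problem (P) with initial datum $u_0$, and let $x_p(t)=\mathcal L^1(\{x\in[0,m]:u(t,x)=0\})$. If for some $\delta>0$ the inequality $$m-B_\gamma\frac{m^{\frac{3\gamma}2}}{\left(\int_{-R}^R|v|^2f_0(v)\,\mathrm dv\right)^{\frac{\gamma-2}2}}\le-\delta$$ holds, then the function $t\mapsto x_p(t)$ cannot be identically zero.
   Context: Let $\Omega=(0,\infty)\times(0,m)$, $\partial_p\Omega=(\{0\}\times[0,m])\cup([0,\infty)\times\{0,m\})$, $F(z,\alpha,p,q)=|p|^\gamma\alpha-|p|^{\gamma-2}q+z(1+|p|^\gamma)$, $\mathcal F(u)=F(u,\partial_tu,\partial_xu,\partial_x^2u)$. Viscosity solutions: a test function is a function that is $C^1$ in $t$ and $C^2$ in $x$. For $\omega\in\Omega$, $\mathcal P^+u(\omega)$ (resp. $\mathcal P^-u(\omega)$) is the set of triples $(\partial_t\phi,\partial_x\phi,\partial_x^2\phi)(\omega)$ where $\phi$ is a test function with $\phi(\omega)=u(\omega)$ and $\phi\ge u$ (resp. $\phi\le u$) near $\omega$. $u$ is a viscosity solution of $\mathcal F(u)=0$ in $\Omega$ if it is continuous and for all $\omega\in\Omega$: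 $F(u(\omega),\alpha,p,q)\le0$ for all $(\alpha,p,q)\in\mathcal P^+u(\omega)$, and $F(u(\omega),\alpha,p,q)\ge0$ for all $(\alpha,p,q)\in\mathcal P^-u(\omega)$. Problem (P): $\mathcal F(u)=0$ in $\Omega$; $u(t,0)=-R$, $u(t,m)=R$ for $t>0$; $u(0,x)=u_0(x)$ for $x\in[0,m]$. For admissible $u_0$ there is a unique viscosity solution $u\in C(\Omega\cup\partial_p\Omega)$ that is non-decreasing in $x$; it is globally Lipschitz. The quantity $x_p(t)$ is the mass at the origin of the measure on $[-R,R]$ whose distribution function is the generalised inverse $M(t,r)=\max\{x\in[0,m]:u(t,x)=r\}$ of $u(t,\cdot)$. *)

(* Defs.v *)
From HB Require Import structures.
From mathcomp Require Import all_boot all_order all_algebra.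
From mathcomp Require Import all_classical all_reals all_analysis.

Set Implicit Arguments.
Unset Strict Implicit.
Unset Printing Implicit Defensive.

Import Order.TTheory GRing.Theory Num.Theory.
Import numFieldNormedType.Exports.

Local Open Scope classical_set_scope.
Local Open Scope ring_scope.

Section CalculusOnSubsets.
Context {R : realType}.
Implicit Types (A : set R) (f : R -> R) (x : R).

(* Derivatives of f as a function on A only: increments stay inside A, so at
   an end point of a closed interval the derivative is one-sided and the values
   of f outside A are irrelevant. *)
Definition diff_quotient f x : R -> R := fun y => (f y - f x) / (y - x).

Definition derivable_on A f x : Prop :=
  cvg (diff_quotient f x @ within (A `\ x) (nbhs x)).

Definition derive1_on A f x : R :=
  lim (diff_quotient f x @ within (A `\ x) (nbhs x)).

Definition C2_on A f : Prop :=
  [/\ forall x, A x -> derivable_on A f x,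
      forall x, A x -> derivable_on A (derive1_on A f) x &
      {within A, continuous (derive1_on A (derive1_on A f))}].

End CalculusOnSubsets.

Section ViscositySolutions.
Context {R : realType}.
Implicit Types (m gamma z a p q : R) (u phi : R * R -> R) (w : R * R).

(* Points of space-time are pairs w = (t, x). *)
Definition Omega m : set (R * R) := `]0, +oo[ `*` `]0, m[.

Definition parabolic_boundary m : set (R * R) :=
  ([set 0] `*` `[0, m]) `|` (`[0, +oo[ `*` [set 0; m]).

Definition d_t phi w : R := derive1 (fun s => phi (s, w.2)) w.1.
Definition d_x phi w : R := derive1 (fun y => phi (w.1, y)) w.2.
Definition d_xx phi : R * R -> R := d_x (d_x phi).

(* C^1 in t and C^2 in x on D: the three derivatives exist and are jointly
   continuous. *)
Definition test_function (D : set (R * R)) phi : Prop :=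
  forall w, D w ->
    [/\ derivable (fun s => phi (s, w.2)) w.1 1,
        derivable (fun y => phi (w.1, y)) w.2 1 &
        derivable (fun y => d_x phi (w.1, y)) w.2 1] /\
    [/\ {for w, continuous (d_t phi)},
        {for w, continuous (d_x phi)} &
        {for w, continuous (d_xx phi)}].

Definition superjet (D : set (R * R)) u w : set (R * R * R) :=
  [set j | exists phi, [/\ test_function D phi, phi w = u w,
     \forall w' \near w, u w' <= phi w' &
     j = (d_t phi w, d_x phi w, d_xx phi w)]].

Definition subjet (D : set (R * R)) u w : set (R * R * R) :=
  [set j | exists phi, [/\ test_function D phi, phi w = u w,
     \forall w' \near w, phi w' <= u w' &
     j = (d_t phi w, d_x phi w, d_xx phi w)]].

(* Since gamma > 2 in all uses, 0 `^ gamma = 0 `^ (gamma - 2) = 0. *)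
Definition F gamma z a p q : R :=
  `|p| `^ gamma * a - `|p| `^ (gamma - 2) * q + z * (1 + `|p| `^ gamma).

Definition viscosity_solution gamma (D : set (R * R)) u : Prop :=
  {within D, continuous u} /\
  forall w, D w ->
    (forall a p q, superjet D u w (a, p, q) -> F gamma (u w) a p q <= 0) /\
    (forall a p q, subjet D u w (a, p, q) -> 0 <= F gamma (u w) a p q).

Definition admissible m (rho : R) (u0 : R -> R) : Prop :=
  [/\ C2_on `[0, m] u0,
      exists x0, [/\ x0 \in `[0, m],
        forall x, x \in `[0, m] ->
          derive1_on `[0, m] u0 x0 <= derive1_on `[0, m] u0 x &
        0 < derive1_on `[0, m] u0 x0],
      u0 0 = - rho & u0 m = rho].

(* Uniqueness holds among solutions that are continuous up to the parabolic
   boundary and non-decreasing in x. *)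
Definition solves_problem gamma m (rho : R) (u0 : R -> R) u : Prop :=
  [/\ {within Omega m `|` parabolic_boundary m, continuous u},
      viscosity_solution gamma (Omega m) u,
      (forall t, 0 < t -> u (t, 0) = - rho /\ u (t, m) = rho),
      (forall x, x \in `[0, m] -> u (0, x) = u0 x) &
      (forall t x y, 0 <= t -> x \in `[0, m] -> y \in `[0, m] -> x <= y ->
         u (t, x) <= u (t, y))].

Definition x_p m u (t : R) : \bar R :=
  lebesgue_measure [set x | x \in `[0, m] /\ u (t, x) = 0].

End ViscositySolutions.

(* Main.v *)
Require Import Defs.
From HB Require Import structures.
From mathcomp Require Import all_boot all_order all_algebra.
From mathcomp Require Import all_classical all_reals all_analysis.
From mathcomp Require Import measurable_realfun.
From mathcomp Require Import ring lra.

Set Implicit Arguments.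
Unset Strict Implicit.
Unset Printing Implicit Defensive.

Import Order.TTheory GRing.Theory Num.Theory.
Import numFieldNormedType.Exports.

Local Open Scope classical_set_scope.
Local Open Scope ring_scope.

(** A small second moment forces a plateau at height [0] in finite time, and
    this can be read off from an explicit supersolution and its mirror image.

    Put [l = m / 8] and let [A = l `^ (gamma / (gamma - 2))], the height at
    which all terms of the equation balance on the length scale [l], the
    corresponding time scale being [A ^+ 2].  If the second moment is below a
    fixed small multiple of [A ^+ 2 * l], which is the meaning of the
    hypothesis once [B] is chosen, Chebyshev's inequality and the monotonicity
    of [u0] give [u0 <= eps * A] on [[0, 7 l]] and [u0 >= - eps * A] on
    [[l, 8 l]] (lemmas [second_moment_ge] and [concentration_lt]).

    On [[0, 7 l]] the solution is then compared with a function
      [W t x = A * (c t + kappa * (1 + L * t / A ^+ 2) * psi ((x - 5 l) / l))],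
    where [psi] vanishes on the negative half line and is very large at [2],
    that is at [x = 7 l], and where [c] decreases from [eps] to almost [0]
    at the time [T = A ^+ 2 / L].  The equation is degenerate: where
    [W] does not depend on [x] its left-hand side is [W >= 0] whatever the time
    derivative, so the plateau [x <= 5 l] may go down at any speed.  To the
    right of it, as long as [psi] is small the slope is so small that the
    zeroth order term [W] dominates, and where [psi] is not small the growth of
    the factor [1 + L * t / A ^+ 2] in front of [psi] beats both the diffusion
    and the decrease of [c]; this is [scaled_supersolution].  Comparison
    ([parabolic_comparison], [subsolution_collapse]) yields [u (T, 5 l) <= 0].

    The equation is invariant under [u (t, x) -> - u (t, m - x)], whence also
    [u (T, 3 l) >= 0].  By monotonicity [u (T, _)] vanishes on [[3 l, 5 l]], an
    interval of length [m / 4], so [x_p] is positive at the time [T]. *)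

(** * The barrier profile *)

Definition pospow {R : realType} (n : nat) (s : R) : R := Num.max s 0 ^+ n.

(** A pole at [2], regularised so that [profile] below is smooth on the whole
    line: test functions have to be global, and the limit [eta -> 0] only
    serves to make the barrier exceed the boundary datum at [s = 2]. *)
Definition pole {R : realType} (eta s : R) : R := ((2 - s) ^+ 2 + eta ^+ 2)^-1.

(** The exponent [k.+3] makes the profile [C^2] across [0]; larger values of
    [k] make its slope decay fast enough there for exponents [gamma] close to
    [2]. *)
Definition profile {R : realType} (k : nat) (eta s : R) : R :=
  pospow k.+3 s * pole eta s.

Definition dprofile {R : realType} (k : nat) (eta s : R) : R :=
  k.+3%:R * pospow k.+2 s * pole eta s +
  2 * (2 - s) * pospow k.+3 s * pole eta s ^+ 2.

Definition ddprofile {R : realType} (k : nat) (eta s : R) : R :=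
  k.+3%:R * k.+2%:R * pospow k.+1 s * pole eta s +
  4 * k.+3%:R * (2 - s) * pospow k.+2 s * pole eta s ^+ 2 +
  pospow k.+3 s * (8 * (2 - s) ^+ 2 * pole eta s ^+ 3 - 2 * pole eta s ^+ 2).

Lemma pospow_le0 {R : realType} (n : nat) (s : R) : s <= 0 -> pospow n.+1 s = 0.
Proof. by move=> s0; rewrite /pospow max_r// exprS mul0r. Qed.

Lemma pospow_ge0E {R : realType} (n : nat) (s : R) : 0 <= s -> pospow n s = s ^+ n.
Proof. by move=> s0; rewrite /pospow max_l. Qed.

Lemma pospow_ge0 {R : realType} (n : nat) (s : R) : 0 <= pospow n s.
Proof. by rewrite /pospow exprn_ge0// le_max lexx orbT. Qed.

Lemma pole_gt0 {R : realType} (eta s : R) : 0 < eta -> 0 < pole eta s.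
Proof. by move=> e0; rewrite invr_gt0 ltr_wpDl ?sqr_ge0// exprn_gt0. Qed.

Lemma profile_le0 {R : realType} (k : nat) (eta s : R) : s <= 0 ->
  [/\ profile k eta s = 0, dprofile k eta s = 0 & ddprofile k eta s = 0].
Proof.
move=> s0; rewrite /profile /dprofile /ddprofile !pospow_le0//.
by split; rewrite !(mulr0, mul0r, addr0).
Qed.

Lemma profile_ge0 {R : realType} (k : nat) (eta s : R) : 0 < eta ->
  0 <= profile k eta s.
Proof. by move=> e0; rewrite mulr_ge0 ?pospow_ge0// ltW// pole_gt0. Qed.

Lemma dprofile_ge0 {R : realType} (k : nat) (eta s : R) : 0 < eta -> s <= 2 ->
  0 <= dprofile k eta s.
Proof.
move=> e0 s2; have i0 := ltW (pole_gt0 s e0).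
have r0 : 0 <= 2 - s by lra.
have := pospow_ge0 k.+2 s; have := pospow_ge0 k.+3 s; rewrite /dprofile.
move: (pospow _ _) (pospow _ _) => y3 y2 ? ?.
by rewrite addr_ge0// !mulr_ge0.
Qed.

(** For [0 <= s <= 1] the pole stays between [1 / 5] and [1], so the profile and its
    derivatives behave like powers, uniformly in [eta]. *)
Lemma profile_near {R : realType} (k : nat) (eta s : R) :
  0 < eta <= 1 -> 0 <= s <= 1 ->
  [/\ s ^+ k.+3 / 5 <= profile k eta s,
      dprofile k eta s <= (k.+3%:R + 4) * s ^+ k.+2 &
      ddprofile k eta s <= (k.+3%:R ^+ 2 + 8 * k.+3%:R + 32) * s ^+ k.+1].
Proof.
move=> /andP[e0 e1] /andP[s0 s1].
have eta2 : eta ^+ 2 <= 1 by rewrite expr_le1// ltW.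
have eta20 : 0 < eta ^+ 2 by rewrite exprn_gt0.
have i0 := pole_gt0 s e0.
have i5 : 5^-1 <= pole eta s.
  rewrite /pole lef_pV2 ?posrE; nra.
have i1 : pole eta s <= 1.
  rewrite /pole -[leRHS]invr1 lef_pV2 ?posrE; nra.
rewrite /profile /dprofile /ddprofile !pospow_ge0E//.
move: (pole eta s) i0 i5 i1 => i i0 i5 i1.
have y0 : 0 <= s ^+ k.+1 by rewrite exprn_ge0.
rewrite !(exprSr _ k.+1) !(exprSr _ k.+2) !(exprSr _ k.+1).
move: (s ^+ k.+1) y0 => y y0.
have -> : k.+2%:R = k.+3%:R - 1 :> R by rewrite -[k.+3]addn1 natrD addrK.
have N0 : (1 : R) <= k.+3%:R by rewrite ler1n.
move: (k.+3%:R : R) N0 => N N0.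
have ys0 : 0 <= y * s by rewrite mulr_ge0.
have yss0 : 0 <= y * s * s by rewrite mulr_ge0.
have ys1 : y * s <= y by rewrite ler_piMr.
have yss1 : y * s * s <= y * s by rewrite ler_piMr.
have ii1 : i ^+ 2 <= 1 by rewrite expr_le1// ltW.
have iii1 : i ^+ 3 <= 1 by rewrite expr_le1// ltW.
have ii0 : 0 <= i ^+ 2 by rewrite exprn_ge0// ltW.
have iii0 : 0 <= i ^+ 3 by rewrite exprn_ge0// ltW.
have r2 : 0 <= 2 - s <= 2 by lra.
have rr4 : 0 <= (2 - s) ^+ 2 <= 4.
  by rewrite sqr_ge0/=; nra.
split.
- by rewrite ler_wpM2l.
- have H1 : N * (y * s) * i <= N * (y * s).
    by rewrite ler_piMr// mulr_ge0//; lra.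
  have H2 : 2 * (2 - s) * (y * s * s) * i ^+ 2 <= 4 * (y * s).
    apply: (@le_trans _ _ (2 * (2 - s) * (y * s * s))).
      by rewrite ler_piMr// !mulr_ge0//; lra.
    by apply: ler_pM => //; lra.
  lra.
- have H1 : N * (N - 1) * y * i <= N ^+ 2 * y.
    apply: (@le_trans _ _ (N * (N - 1) * y)).
      by rewrite ler_piMr// !mulr_ge0//; lra.
    by rewrite ler_wpM2r//; lra.
  have H2 : 4 * N * (2 - s) * (y * s) * i ^+ 2 <= 8 * N * y.
    apply: (@le_trans _ _ (4 * N * (2 - s) * (y * s))).
      by rewrite ler_piMr// !mulr_ge0//; lra.
    by apply: ler_pM => //; [apply: mulr_ge0; lra | nra].
  have H3 : y * s * s * (8 * (2 - s) ^+ 2 * i ^+ 3 - 2 * i ^+ 2) <= 32 * y.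
    apply: (@le_trans _ _ (y * s * s * 32)); last by lra.
    apply: ler_wpM2l => //.
    have : (2 - s) ^+ 2 * i ^+ 3 <= 4 * 1 by apply: ler_pM => //; lra.
    lra.
  lra.
Qed.

(** Near a pole of any order [psi''] is at most of the order of
    [psi' ^+ 2 * psi].  Thus a time derivative proportional to [psi] controls
    the diffusion, uniformly in [eta]. *)
Lemma profile_far {R : realType} (k : nat) (eta s : R) :
  0 < eta <= 1 -> 1 <= s <= 2 ->
  2^-1 <= profile k eta s /\
  ddprofile k eta s <= 8 * (dprofile k eta s ^+ 2 * profile k eta s).
Proof.
move=> /andP[e0 e1] /andP[s1 s2].
have s0 : 0 <= s by lra.
have eta2 : eta ^+ 2 <= 1 by rewrite expr_le1// ltW.
have eta20 : 0 < eta ^+ 2 by rewrite exprn_gt0.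
have i0 := pole_gt0 s e0.
have i2 : 2^-1 <= pole eta s.
  rewrite /pole lef_pV2 ?posrE; nra.
rewrite /profile /dprofile /ddprofile !pospow_ge0E//.
move: (pole eta s) i0 i2 => i i0 i2.
have y1 : 1 <= s ^+ k.+1 by rewrite exprn_ege1.
rewrite !(exprSr _ k.+1) !(exprSr _ k.+2) !(exprSr _ k.+1).
move: (s ^+ k.+1) y1 => y y1.
have -> : k.+2%:R = k.+3%:R - 1 :> R by rewrite -[k.+3]addn1 natrD addrK.
have N0 : (1 : R) <= k.+3%:R by rewrite ler1n.
move: (k.+3%:R : R) N0 => N N0.
split.
  have : 1 <= y * s * s by rewrite !mulr_ege1.
  by move=> H; rewrite -[leLHS]mul1r ler_pM.
pose r := 2 - s; have r0 : 0 <= r by rewrite /r; lra.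
rewrite -/r.
(* [T] is the square of [N + 2 * r * s * i], and each summand of the second
   derivative is bounded by the matching summand of [2 * y * i * T]. *)
set T := N ^+ 2 + 4 * N * r * s * i + 4 * r ^+ 2 * s ^+ 2 * i ^+ 2.
have T0 : 0 <= T.
  rewrite /T !addr_ge0 ?sqr_ge0// ?mulr_ge0 ?sqr_ge0//; lra.
apply: (@le_trans _ _ (2 * (y * i) * T)).
  have yi0 : 0 <= y * i by apply: mulr_ge0; lra.
  rewrite -subr_ge0.
  rewrite [X in 0 <= X](_ : _ = (y * i) *
     (N ^+ 2 + N + 4 * N * r * s * i + 2 * s ^+ 2 * i)); last by rewrite /T; ring.
  rewrite mulr_ge0// !addr_ge0// ?sqr_ge0 ?mulr_ge0 ?sqr_ge0//; lra.
have -> : 8 * ((N * (y * s) * i + 2 * r * (y * s * s) * i ^+ 2) ^+ 2 *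
     (y * s * s * i)) = (2 * (y * i) * T) * ((4 * i ^+ 2) * (y ^+ 2 * s ^+ 4)).
  by rewrite /T; ring.
rewrite ler_peMr//.
  by rewrite !mulr_ge0//; lra.
rewrite mulr_ege1//.
  nra.
by rewrite mulr_ege1// exprn_ege1.
Qed.

(** The supersolution inequality in rescaled variables, with the power
    [p `^ (gamma - 2)] of the slope [p] factored out of the evolution and
    diffusion terms: the barrier is [c + kappa * b * profile] with
    [b = 1 + L * time], so [dc + kappa * L * profile] is its time derivative.
    For [s <= 1] we have [p `^ (gamma - 2) <= mu * s ^+ 2] with [mu] small, and
    the zeroth order term wins; for [s >= 1] the choice [L = 16 / kappa ^+ 2]
    makes [p ^+ 2] times the time derivative exceed the diffusion.  The
    constant [eps] is chosen last, so that the allowed decrease [dc] of the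
    plateau is harmless in both regions. *)
Lemma scaled_supersolution {R : realType} (gamma : R) : 2 < gamma ->
  exists k : nat, exists kappa eps L : R,
  [/\ 0 < kappa, 0 < eps, 0 < L &
    forall eta s b c dc p : R, 0 < eta <= 1 -> s <= 2 -> 1 <= b <= 3 ->
      0 <= c -> - (2 * L * eps) <= dc ->
      p = kappa * b * dprofile k eta s ->
      0 <= p `^ (gamma - 2) *
             (p ^+ 2 * (dc + kappa * L * profile k eta s) -
              kappa * b * ddprofile k eta s) +
           (c + kappa * b * profile k eta s)].
Proof.
move=> g2; have g0 : 0 < gamma - 2 by rewrite subr_gt0.
pose k := Num.truncn (2 / (gamma - 2)).
(* this makes the slope to the power [gamma - 2] at most quadratic in [s] *)
have kg : 2 <= k.+2%:R * (gamma - 2).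
  rewrite -ler_pdivrMr//; apply: ltW; apply: (lt_trans (truncnS_gt _)).
  by rewrite ltr_nat.
pose C1 : R := k.+3%:R + 4.
pose C2 : R := k.+3%:R ^+ 2 + 8 * k.+3%:R + 32.
have N0 : 0 < (k.+3%:R : R) by rewrite ltr0n.
have C10 : 0 < C1 by rewrite /C1 addr_gt0.
have C20 : 0 < C2 by rewrite /C2 !addr_gt0// ?mulr_gt0// ?exprn_gt0.
(* [C1] and [C2] are the constants of [profile_near]; the value of [mu] makes
   [mu * (1 + 3 * C2)] equal to [1 / 5], the lower bound of
   [profile / s ^+ k.+3] found there *)
pose mu := (5 * (1 + 3 * C2))^-1.
have mu0 : 0 < mu by rewrite invr_gt0; lra.
pose p1 := mu `^ (gamma - 2)^-1.
have p10 : 0 < p1 by rewrite powR_gt0.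
have p1E : p1 `^ (gamma - 2) = mu.
  by rewrite /p1 -powRrM mulVf ?gt_eqF// powRr1// ltW.
pose kappa := p1 / (3 * C1).
have kappa0 : 0 < kappa by rewrite divr_gt0// mulr_gt0.
have kappaE : 3 * kappa * C1 = p1.
  by rewrite /kappa; field; rewrite gt_eqF.
pose L := 16 / kappa ^+ 2.
have L0 : 0 < L by rewrite divr_gt0// exprn_gt0.
have LE : kappa ^+ 2 * L = 16 by rewrite /L mulrC divfK// gt_eqF// exprn_gt0.
pose eps := kappa / (8 + 2 * L * p1 ^+ 2).
have den0 : 0 < 8 + 2 * L * p1 ^+ 2.
  by have : 0 < L * p1 ^+ 2; [rewrite mulr_gt0// exprn_gt0|lra].
have eps0 : 0 < eps by rewrite divr_gt0.
have epsE : eps * 8 + eps * (2 * L * p1 ^+ 2) = kappa.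
  by rewrite -mulrDr divfK// gt_eqF.
clearbody eps L kappa p1.
exists k, kappa, eps, L; split => // eta s b c dc p etaP s2 bP c0 dcP pE.
have /andP[eta0 _] := etaP.
have psi0 := profile_ge0 k s eta0.
have b0 : 0 < b by lra.
have kb0 : 0 < kappa * b by rewrite mulr_gt0.
have V0 : 0 <= c + kappa * b * profile k eta s.
  by rewrite addr_ge0// mulr_ge0// ltW.
have [s0|s0] := leP s 0.
  have [_ dE ddE] := profile_le0 k eta s0.
  by rewrite pE dE ddE !mulr0 powR0 ?gt_eqF// mul0r add0r.
have dpsi0 := dprofile_ge0 k eta0 s2.
have p0 : 0 <= p by rewrite pE mulr_ge0// ltW.
have pw0 : 0 <= p `^ (gamma - 2) by rewrite powR_ge0.
have [s1|s1] := leP s 1.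
  have [psiP dP ddP] := profile_near k (etaP) (introT andP (conj (ltW s0) s1)).
  have y0 : 0 < s ^+ k.+1 by rewrite exprn_gt0.
  have ple : p <= p1 * s ^+ k.+2.
    rewrite pE -kappaE; apply: (@le_trans _ _ (kappa * b * (C1 * s ^+ k.+2))).
      by rewrite ler_wpM2l// ltW.
    have K0 : 0 <= kappa * C1 * s ^+ k.+2.
      by rewrite mulr_ge0 ?exprn_ge0 ?(ltW s0)// mulr_ge0// ltW.
    rewrite [leLHS](_ : _ = b * (kappa * C1 * s ^+ k.+2)); last by ring.
    by rewrite -!(mulrA 3) ler_wpM2r//; lra.
  have pwle : p `^ (gamma - 2) <= mu * s ^+ 2.
    apply: (@le_trans _ _ ((p1 * s ^+ k.+2) `^ (gamma - 2))).
      apply: ge0_ler_powR; rewrite ?nnegrE//; first exact: ltW.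
      by rewrite mulr_ge0 ?(ltW p10)// exprn_ge0// ltW.
    rewrite (powRM _ (ltW p10)) ?exprn_ge0 ?(ltW s0)// p1E ler_pM2l//.
    rewrite -powR_mulrn ?(ltW s0)// -powRrM -powR_mulrn ?(ltW s0)//.
    by apply: ger_powR; rewrite ?s0.
  have s2ge0 : 0 <= s ^+ 2 by rewrite sqr_ge0.
  pose Z := kappa * (1 + 3 * C2) * s ^+ k.+1.
  have Z0 : 0 <= Z by rewrite /Z mulr_ge0 ?(ltW y0)// mulr_ge0 ?(ltW kappa0)//; lra.
  have XZ : - Z <= p ^+ 2 * (dc + kappa * L * profile k eta s) -
              kappa * b * ddprofile k eta s.
    have A1 : kappa * b * ddprofile k eta s <= kappa * 3 * C2 * s ^+ k.+1.
      have dd0 : 0 <= C2 * s ^+ k.+1 by rewrite mulr_ge0// ltW.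
      apply: (@le_trans _ _ (kappa * b * (C2 * s ^+ k.+1))).
        by rewrite ler_wpM2l// ltW.
      by rewrite -!mulrA ler_pM2l// ler_wpM2r//; lra.
    have A2 : - (2 * L * eps) <= dc + kappa * L * profile k eta s.
      have : 0 <= kappa * L * profile k eta s.
        by apply: mulr_ge0 => //; rewrite mulr_ge0// ltW.
      lra.
    have A3 : p ^+ 2 <= p1 ^+ 2 * s ^+ k.+1.
      apply: (@le_trans _ _ ((p1 * s ^+ k.+2) ^+ 2)).
        by rewrite lerXn2r// nnegrE// mulr_ge0// ?exprn_ge0// ltW.
      rewrite exprMn ler_wpM2l ?sqr_ge0// -exprM mulnC.
      by apply: ler_wiXn2l => //; rewrite ?(ltW s0)// mul2n -addnn addSnnS leq_addr.
    have A4 : - (p1 ^+ 2 * s ^+ k.+1 * (2 * L * eps)) <=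
        p ^+ 2 * (dc + kappa * L * profile k eta s).
      have [Xp|Xn] := leP 0 (dc + kappa * L * profile k eta s).
        apply: (@le_trans _ _ 0).
          by rewrite oppr_le0 !mulr_ge0// ?sqr_ge0// ltW.
        by rewrite mulr_ge0// sqr_ge0.
      rewrite lerNl -mulrN; apply: ler_pM; rewrite ?sqr_ge0//; lra.
    have A5 : p1 ^+ 2 * s ^+ k.+1 * (2 * L * eps) <= kappa * s ^+ k.+1.
      rewrite mulrAC ler_pM2r//; lra.
    rewrite /Z; lra.
  have muE : mu * (1 + 3 * C2) = 5^-1 by rewrite /mu; field; lra.
  have pwX : - (kappa * s ^+ k.+3 / 5) <= p `^ (gamma - 2) *
             (p ^+ 2 * (dc + kappa * L * profile k eta s) -
              kappa * b * ddprofile k eta s).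
    apply: (@le_trans _ _ (p `^ (gamma - 2) * - Z)); last by rewrite ler_wpM2l.
    rewrite mulrN lerN2; apply: (@le_trans _ _ (mu * s ^+ 2 * Z)).
      by rewrite ler_wpM2r.
    rewrite /Z [leLHS](_ : _ = (mu * (1 + 3 * C2)) * kappa * (s ^+ k.+1 * s ^+ 2));
      last by ring.
    by rewrite -exprD addn2 muE; lra.
  have kpsi : kappa * s ^+ k.+3 / 5 <= kappa * b * profile k eta s.
    apply: (@le_trans _ _ (kappa * profile k eta s)).
      by rewrite -mulrA ler_pM2l.
    by rewrite ler_wpM2r// ler_peMr//; [exact: ltW|case/andP: bP].
  lra.
have [psiP ddP] := profile_far k etaP (introT andP (conj (ltW s1) s2)).
rewrite addr_ge0// mulr_ge0// subr_ge0.
have A1 : kappa * L * profile k eta s / 2 <= dc + kappa * L * profile k eta s.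
  have : 2 * L * eps <= kappa * L * profile k eta s / 2.
    have -> : 2 * L * eps = L * (2 * eps) by ring.
    have -> : kappa * L * profile k eta s / 2 = L * (kappa * profile k eta s / 2) by ring.
    rewrite ler_pM2l//.
    have : kappa / 2 <= kappa * profile k eta s by rewrite ler_pM2l.
    have : 0 <= eps * (2 * L * p1 ^+ 2) by rewrite !mulr_ge0// ?sqr_ge0// ltW.
    lra.
  lra.
apply: (@le_trans _ _ (p ^+ 2 * (kappa * L * profile k eta s / 2))); last first.
  by rewrite ler_wpM2l// sqr_ge0.
rewrite pE [leRHS](_ : _ = kappa * b * (b * (kappa ^+ 2 * L) / 2 *
   (dprofile k eta s ^+ 2 * profile k eta s))); last by ring.
rewrite ler_pM2l// LE; apply: (le_trans ddP); rewrite ler_wpM2r//; last by lra.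
by rewrite mulr_ge0// sqr_ge0.
Qed.

(** * Derivatives of the profile *)

Lemma pospow_continuous {R : realType} (n : nat) :
  continuous (pospow n : R -> R).
Proof.
move=> x; have cm : {for x, continuous (fun s : R => Num.max s 0)}.
  apply: (@continuous_max _ _ id (cst 0)); first exact: cvg_id.
  exact: cst_continuous.
exact: (continuous_comp cm (@exprn_continuous R n _)).
Qed.

Lemma is_derive_pospow {R : realType} (n : nat) (x : R) :
  is_derive x (1 : R) (pospow n.+2) (n.+2%:R * pospow n.+1 x).
Proof.
have [x0|x0|->] := ltgtP x 0.
- rewrite pospow_le0 ?ltW// mulr0.
  have E : \forall y \near x, cst 0 y = pospow n.+2 y.
    near=> y; rewrite /= pospow_le0// ltW//; near: y.
    exact: lt_nbhsl.
  by apply: near_eq_is_derive E _; exact: is_derive_cst.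
- rewrite pospow_ge0E ?ltW//.
  have E : \forall y \near x, y ^+ n.+2 = pospow n.+2 y.
    near=> y; rewrite /= pospow_ge0E// ltW//; near: y.
    exact: lt_nbhsr.
  apply: near_eq_is_derive E _.
  by apply: DeriveDef; [exact: exprn_derivable|rewrite exp_derive [LHS]mulr1].
- (* at [0], use the factorisation [pospow n.+2 z = pospow n.+1 z * z] *)
  rewrite pospow_le0// mulr0; apply/is_derive1_caratheodory.
  exists (pospow n.+1); split; [|exact: pospow_continuous|exact: pospow_le0].
  move=> z; rewrite (@pospow_le0 _ n.+1 0)// !subr0.
  have [z0|z0] := leP z 0; first by rewrite !pospow_le0// mul0r.
  by rewrite !pospow_ge0E ?ltW// [LHS]exprSr.
Unshelve. all: by end_near. Qed.

Lemma is_derive_mul {R : realType} (f g : R -> R) (x a b : R) :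
  is_derive x (1 : R) f a -> is_derive x (1 : R) g b ->
  is_derive x (1 : R) (fun y => f y * g y) (a * g x + f x * b).
Proof.
move=> Hf Hg; rewrite (_ : _ + _ = f x *: b + g x *: a); first exact: is_deriveM.
by rewrite addrC /GRing.scale/= (mulrC (g x)).
Qed.

Lemma is_derive_add {R : realType} (f g : R -> R) (x a b : R) :
  is_derive x (1 : R) f a -> is_derive x (1 : R) g b ->
  is_derive x (1 : R) (fun y => f y + g y) (a + b).
Proof. exact: is_deriveD. Qed.

Lemma is_derive_pole {R : realType} (eta x : R) : 0 < eta ->
  is_derive x (1 : R) (pole eta) (2 * (2 - x) * pole eta x ^+ 2).
Proof.
move=> e0; have p0 := pole_gt0 x e0.
have lin : is_derive x (1 : R) (fun y : R => 2 - y) (- 1).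
  rewrite -[- 1]add0r.
  exact: (is_derive_add (is_derive_cst _ _ _) (is_deriveNid _ _)).
have den : is_derive x (1 : R) (fun y : R => (2 - y) ^+ 2 + eta ^+ 2) (- (2 * (2 - x))).
  rewrite -[- (2 * _)]addr0.
  apply: (is_derive_add _ (is_derive_cst _ _ _)).
  rewrite (_ : - _ = - 1 * (2 - x) + (2 - x) * - 1); last by ring.
  exact: is_derive_mul.
have nz : (2 - x) ^+ 2 + eta ^+ 2 != 0 by rewrite -invr_eq0 gt_eqF.
rewrite (_ : _ * _ = - ((2 - x) ^+ 2 + eta ^+ 2) ^- 2 *: - (2 * (2 - x))).
  exact: (@is_deriveV _ (fun y => (2 - y) ^+ 2 + eta ^+ 2) _ _ _ nz den).
by rewrite /GRing.scale/= /pole exprVn; ring.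
Qed.

Lemma is_derive_profile {R : realType} (k : nat) (eta x : R) : 0 < eta ->
  is_derive x (1 : R) (profile k eta) (dprofile k eta x).
Proof.
move=> e0; apply: is_derive_eq.
  exact: (is_derive_mul (is_derive_pospow k.+1 x) (is_derive_pole x e0)).
by rewrite /dprofile; ring.
Qed.

Lemma is_derive_dprofile {R : realType} (k : nat) (eta x : R) : 0 < eta ->
  is_derive x (1 : R) (dprofile k eta) (ddprofile k eta x).
Proof.
move=> e0; have Di := is_derive_pole x e0.
have Dc (a : R) : is_derive x (1 : R) (fun _ => a) 0 by exact: is_derive_cst.
have Dn : is_derive x (1 : R) (fun y : R => - y) (- 1) by exact: is_deriveNid.
have Dl := is_derive_mul (Dc 2) (is_derive_add (Dc 2) Dn).
have D1 := is_derive_mul (is_derive_mul (Dc k.+3%:R) (is_derive_pospow k x)) Di.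
have D2 := is_derive_mul (is_derive_mul Dl (is_derive_pospow k.+1 x))
             (is_derive_mul Di Di).
case: (is_derive_add D1 D2) => d e.
apply: DeriveDef; first exact: d.
apply: (etrans e).
by rewrite /ddprofile; ring.
Qed.

Lemma ddprofile_continuous {R : realType} (k : nat) (eta : R) : 0 < eta ->
  continuous (ddprofile k eta).
Proof.
move=> e0 x.
have ci : pole eta y @[y --> x] --> pole eta x.
  apply: differentiable_continuous; apply/derivable1_diffP.
  by have [] := is_derive_pole x e0.
have cp n : pospow n y @[y --> x] --> pospow n x by exact: pospow_continuous.
have cl : 2 - y @[y --> x] --> 2 - x by apply: cvgB; [exact: cvg_cst|exact: cvg_id].
have cX n (f : R -> R) : f y @[y --> x] --> f x -> f y ^+ n @[y --> x] --> f x ^+ n.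
  move=> cf; have cf' : {for x, continuous f} by [].
  exact: (continuous_comp cf' (@exprn_continuous R n _)).
rewrite /ddprofile.
apply: cvgD; first apply: cvgD.
- apply: cvgM ci; apply: cvgM (cp _); exact: cvg_cst.
- apply: cvgM (cX _ _ ci); apply: cvgM (cp _); apply: cvgM cl; exact: cvg_cst.
- apply: cvgM; first exact: cp.
  apply: cvgB; apply: cvgM (cX _ _ ci); last exact: cvg_cst.
  apply: cvgM (cX _ _ cl); exact: cvg_cst.
Qed.

(** * Separable test functions *)

Section SeparableTestFunctions.
Context {R : realType}.
Implicit Types (gamma m : R) (c b g : R -> R) (u : R * R -> R).

(** Every test function needed below has this form, whose derivatives on the
    whole plane come from one-variable calculus. *)
Definition separable c b g : R * R -> R := fun w => c w.1 + b w.1 * g w.2.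

Lemma separable_test_function c dc b db g dg ddg (D : set (R * R)) :
  (forall t, is_derive t (1 : R) c (dc t)) ->
  (forall t, is_derive t (1 : R) b (db t)) ->
  (forall x, is_derive x (1 : R) g (dg x)) ->
  (forall x, is_derive x (1 : R) dg (ddg x)) ->
  continuous dc -> continuous db -> continuous ddg ->
  [/\ test_function D (separable c b g),
      d_t (separable c b g) = (fun w => dc w.1 + db w.1 * g w.2),
      d_x (separable c b g) = (fun w => b w.1 * dg w.2) &
      d_xx (separable c b g) = (fun w => b w.1 * ddg w.2)].
Proof.
move=> Dc Db Dg Ddg cdc cdb cddg.
have cstD (a x : R) : is_derive x (1 : R) (fun _ => a) 0 by exact: is_derive_cst.
have derc (f df : R -> R) : (forall x, is_derive x (1 : R) f (df x)) -> continuous f.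
  move=> Df x; apply: differentiable_continuous; apply/derivable1_diffP.
  by have [] := Df x.
have Dt w : is_derive w.1 (1 : R) (fun s => separable c b g (s, w.2))
    (dc w.1 + db w.1 * g w.2).
  rewrite /separable/= -[db _ * _]addr0 -[X in _ + (_ + X)](mulr0 (b w.1)).
  exact: (is_derive_add (Dc _) (is_derive_mul (Db _) (cstD (g w.2) w.1))).
have Dx w : is_derive w.2 (1 : R) (fun y => separable c b g (w.1, y)) (b w.1 * dg w.2).
  rewrite /separable/= -[_ * _]add0r -[b _ * _]add0r -[X in _ + (X + _)](mul0r (g w.2)).
  exact: (is_derive_add (cstD (c w.1) w.2) (is_derive_mul (cstD (b w.1) _) (Dg _))).
have Dxx w : is_derive w.2 (1 : R) (fun y => b w.1 * dg y) (b w.1 * ddg w.2).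
  rewrite -[b _ * _]add0r -[X in X + _](mul0r (dg w.2)).
  exact: (is_derive_mul (cstD (b w.1) _) (Ddg _)).
have dtE : d_t (separable c b g) = (fun w => dc w.1 + db w.1 * g w.2).
  by apply/funext => w; rewrite /d_t derive1E; have [_ ->] := Dt w.
have dxE : d_x (separable c b g) = (fun w => b w.1 * dg w.2).
  by apply/funext => w; rewrite /d_x derive1E; have [_ ->] := Dx w.
have dxxE : d_xx (separable c b g) = (fun w => b w.1 * ddg w.2).
  by apply/funext => w; rewrite /d_xx dxE /d_x derive1E; have [_ ->] := Dxx w.
have c1 (f : R -> R) (w : R * R) : continuous f -> f z.1 @[z --> w] --> f w.1.
  move=> cf; have h : {for w, continuous (@fst R R)} by exact: cvg_fst.
  exact: (continuous_comp h (cf _)).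
have c2 (f : R -> R) (w : R * R) : continuous f -> f z.2 @[z --> w] --> f w.2.
  move=> cf; have h : {for w, continuous (@snd R R)} by exact: cvg_snd.
  exact: (continuous_comp h (cf _)).
split => // w _; split; split.
- by have [] := Dt w.
- by have [] := Dx w.
- by rewrite dxE; have [] := Dxx w.
- rewrite dtE; apply: cvgD; first exact: c1.
  by apply: cvgM; [exact: c1|exact: c2 (derc _ _ Dg)].
- rewrite dxE; apply: cvgM; first exact: c1 (derc _ _ Db).
  exact: c2 (derc _ _ Ddg).
- rewrite dxxE; apply: cvgM; first exact: c1 (derc _ _ Db).
  exact: c2.
Qed.

(** What comparison with a barrier requires of [u].  Restricted to separable
    test functions, the property is easily carried over from [u] to the
    reflected function [- u (t, m - x)]. *)
Definition separable_subsolution gamma m u : Prop :=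
  forall c dc b db g dg ddg : R -> R,
  (forall t, is_derive t (1 : R) c (dc t)) ->
  (forall t, is_derive t (1 : R) b (db t)) ->
  (forall x, is_derive x (1 : R) g (dg x)) ->
  (forall x, is_derive x (1 : R) dg (ddg x)) ->
  continuous dc -> continuous db -> continuous ddg ->
  forall t x, 0 < t -> 0 < x < m -> u (t, x) = separable c b g (t, x) ->
  (\forall w \near (t, x), u w <= separable c b g w) ->
  F gamma (u (t, x)) (dc t + db t * g x) (b t * dg x) (b t * ddg x) <= 0.

Lemma F_odd gamma (z a p q : R) : F gamma (- z) (- a) p (- q) = - F gamma z a p q.
Proof. by rewrite /F; ring. Qed.

Lemma viscosity_separable_subsolution gamma m u :
  viscosity_solution gamma (Omega m) u -> separable_subsolution gamma m u.
Proof.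
move=> [_ visc] c dc b db g dg ddg Dc Db Dg Ddg cdc cdb cddg t x t0 xm ut near_u.
have [test dtE dxE dxxE] :=
  separable_test_function (Omega m) Dc Db Dg Ddg cdc cdb cddg.
have Ow : Omega m (t, x) by split; rewrite /= in_itv/= ?t0.
have [sub _] := visc _ Ow; apply: sub.
by exists (separable c b g); rewrite dtE dxE dxxE; split.
Qed.

(** Reflecting a separable function that touches [- u (t, m - x)] from above
    gives a separable function that touches [u] from below, with the same slope
    and opposite time and second derivatives; as [F] is odd in the remaining
    variables, the supersolution inequality becomes the subsolution one. *)
Lemma viscosity_separable_subsolution_reflect gamma m u :
  viscosity_solution gamma (Omega m) u ->
  separable_subsolution gamma m (fun w => - u (w.1, m - w.2)).
Proof.
move=> [_ visc] c dc b db g dg ddg Dc Db Dg Ddg cdc cdb cddg t x t0 xm /= ut near_u.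
have Dm y : is_derive y (1 : R) (fun z : R => m - z) (- 1).
  have Dc0 : is_derive y (1 : R) (fun _ => m) 0 by exact: is_derive_cst.
  have Dn : is_derive y (1 : R) (fun z : R => - z) (- 1) by exact: is_deriveNid.
  by rewrite -[- 1]add0r; exact: (is_derive_add Dc0 Dn).
have Dcomp (f df : R -> R) : (forall y, is_derive y (1 : R) f (df y)) ->
    forall y, is_derive y (1 : R) (fun z => - f (m - z)) (df (m - y)).
  move=> Df y; case: (is_deriveN (@is_derive1_comp _ f (fun z => m - z) y _ _ (Df (m - y)) (Dm y))) => d e.
  by apply: DeriveDef; [exact: d|apply: (etrans e); rewrite mulrN1 opprK].
have Dg' y : is_derive y (1 : R) (fun z => - g (m - z)) (dg (m - y)) by exact: Dcomp.
have Ddg' y : is_derive y (1 : R) (fun z => dg (m - z)) (- ddg (m - y)).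
  case: (@is_derive1_comp _ dg (fun z => m - z) y _ _ (Ddg (m - y)) (Dm y)) => d e.
  by apply: DeriveDef; [exact: d|apply: (etrans e); rewrite mulrN1].
have Dc' s : is_derive s (1 : R) (fun z => - c z) (- dc s) by exact: is_deriveN.
have cdc' : continuous (fun s => - dc s) by move=> s; apply: cvgN; exact: cdc.
have cddg' : continuous (fun y => - ddg (m - y)).
  move=> y; apply: cvgN; have h : {for y, continuous (fun z => m - z)}.
    by apply: cvgB; [exact: cvg_cst|exact: cvg_id].
  exact: (continuous_comp h (cddg _)).
have [test dtE dxE dxxE] :=
  separable_test_function (Omega m) Dc' Db Dg' Ddg' cdc' cdb cddg'.
have Ow : Omega m (t, m - x).
  by move/andP: xm => [x0 xm]; split; rewrite /= in_itv/= ?t0// subr_gt0 xm gtrBl.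
have uE : u (t, m - x) = - (c t + b t * g x) by rewrite -[LHS]opprK ut.
have [_ super] := visc _ Ow.
rewrite -oppr_ge0 -F_odd opprK.
rewrite opprD -!mulrN.
apply: super.
exists (separable (fun s => - c s) b (fun y => - g (m - y))); rewrite dtE dxE dxxE/=.
rewrite subKr; split => //.
  by rewrite /separable/= subKr uE opprD mulrN.
have refl_cvg : (fun w : R * R => (w.1, m - w.2)) @ (t, m - x) --> (t, m - (m - x)).
  have h1 : w.1 @[w --> (t, m - x)] --> t by exact: cvg_fst.
  have h2 : m - w.2 @[w --> (t, m - x)] --> m - (m - x).
    by apply: cvgB; [exact: cvg_cst|exact: cvg_snd].
  exact: (cvg_pair h1 h2).
rewrite subKr in refl_cvg.
near=> w.
have : - u (w.1, m - (m - w.2)) <= separable c b g (w.1, m - w.2).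
  by near: w; exact: refl_cvg near_u.
rewrite subKr -surjective_pairing /separable/= => h.
rewrite mulrN -opprD; lra.
Unshelve. all: by end_near. Qed.

End SeparableTestFunctions.

(** * Comparison with a separable supersolution *)

(** At an interior positive maximum [M] of [u - W] the function [W + M] touches
    [u] from above.  Since [F] is strictly increasing in [z] this contradicts
    [F >= 0] along [W].  The term [z * |p| ^ gamma] of [F] is nonnegative here
    and is dropped from the condition on [W].  The final time [T] belongs to
    the set where [u <= W] is assumed, because test functions touch on a
    two-sided neighbourhood in time. *)
Lemma parabolic_comparison {R : realType} (gamma m T X : R) (u : R * R -> R)
    (c dc b db g dg ddg : R -> R) :
  0 < T -> 0 < X -> X <= m ->
  {within `[0, T] `*` `[0, X], continuous u} ->
  separable_subsolution gamma m u ->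
  (forall t, is_derive t (1 : R) c (dc t)) ->
  (forall t, is_derive t (1 : R) b (db t)) ->
  (forall x, is_derive x (1 : R) g (dg x)) ->
  (forall x, is_derive x (1 : R) dg (ddg x)) ->
  continuous dc -> continuous db -> continuous ddg ->
  (forall t x, 0 < t < T -> 0 < x < X ->
    [/\ 0 <= separable c b g (t, x), 0 <= b t * dg x &
      0 <= (b t * dg x) `^ gamma * (dc t + db t * g x) -
           (b t * dg x) `^ (gamma - 2) * (b t * ddg x) + separable c b g (t, x)]) ->
  (forall t x, 0 <= t <= T -> 0 <= x <= X ->
    [\/ t = 0, t = T, x = 0 | x = X] -> u (t, x) <= separable c b g (t, x)) ->
  forall t x, 0 <= t <= T -> 0 <= x <= X -> u (t, x) <= separable c b g (t, x).
Proof.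
move=> T0 X0 Xm cu sub Dc Db Dg Ddg cdc cdb cddg super bdry.
have derc (f df : R -> R) : (forall x, is_derive x (1 : R) f (df x)) -> continuous f.
  move=> Df x; apply: differentiable_continuous; apply/derivable1_diffP.
  by have [] := Df x.
have cW : continuous (separable c b g).
  move=> w; rewrite /separable.
  have h1 : {for w, continuous (@fst R R)} by exact: cvg_fst.
  have h2 : {for w, continuous (@snd R R)} by exact: cvg_snd.
  apply: cvgD; first exact: (continuous_comp h1 (derc _ _ Dc _)).
  by apply: cvgM; [exact: (continuous_comp h1 (derc _ _ Db _))
                  |exact: (continuous_comp h2 (derc _ _ Dg _))].
pose K : set (R * R) := `[0, T] `*` `[0, X].
have inK t x : 0 <= t <= T -> 0 <= x <= X -> (t, x) \in K.
  by move=> tT xX; rewrite inE; split; rewrite /= in_itv.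
have K0 : K !=set0.
  exists (0, 0); split; rewrite /= in_itv/= lexx/=; exact: ltW.
have cK : compact K by apply: compact_setX; exact: segment_compact.
have cf : {within K, continuous (fun w => u w - separable c b g w)}.
  move=> w; apply: continuousB; first exact: cu.
  exact: continuous_subspaceT.
have [[t x] /[!inE] -[/= tT xX] maxf] := compact_EVT_max K0 cK cf.
move: tT xX; rewrite !in_itv/= => tT xX.
suff M0 : u (t, x) - separable c b g (t, x) <= 0.
  move=> s y sT yX; rewrite -subr_le0; apply: le_trans M0.
  by apply: maxf; exact: inK.
rewrite leNgt; apply/negP => M0.
set M := u (t, x) - separable c b g (t, x) in M0.
have nb : ~ [\/ t = 0, t = T, x = 0 | x = X].
  by move=> /(bdry _ _ tT xX); rewrite -subr_le0 -/M leNgt M0.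
have t0 : 0 < t.
  by case/andP: tT => h _; rewrite lt_neqAle h andbT; apply/eqP => e; apply: nb; constructor 1.
have t1 : t < T.
  by case/andP: tT => _ h; rewrite lt_neqAle h andbT; apply/eqP => e; apply: nb; constructor 2.
have x0 : 0 < x.
  by case/andP: xX => h _; rewrite lt_neqAle h andbT; apply/eqP => e; apply: nb; constructor 3.
have x1 : x < X.
  by case/andP: xX => _ h; rewrite lt_neqAle h andbT; apply/eqP => e; apply: nb; constructor 4.
have [W0 p0 superW] := super _ _ (introT andP (conj t0 t1)) (introT andP (conj x0 x1)).
have DcM s : is_derive s (1 : R) (fun s => c s + M) (dc s).
  have DM : is_derive s (1 : R) (fun _ => M) 0 by exact: is_derive_cst.
  by rewrite -[dc s]addr0; exact: (is_derive_add (Dc s) DM).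
have touch : u (t, x) = separable (fun s => c s + M) b g (t, x).
  by rewrite /M /separable/=; ring.
have near_u : \forall w \near (t, x), u w <= separable (fun s => c s + M) b g w.
  have n1 : \forall w \near (t, x), w.1 \in `]0, T[.
    have h : {for (t, x), continuous (@fst R R)} by exact: cvg_fst.
    have k : \forall s \near t, s \in `]0, T[ by apply: near_in_itvoo; rewrite in_itv/= t0.
    exact: (h _ k).
  have n2 : \forall w \near (t, x), w.2 \in `]0, X[.
    have h : {for (t, x), continuous (@snd R R)} by exact: cvg_snd.
    have k : \forall s \near x, s \in `]0, X[ by apply: near_in_itvoo; rewrite in_itv/= x0.
    exact: (h _ k).
  near=> w.
  have : w.1 \in `]0, T[ by near: w.
  have : w.2 \in `]0, X[ by near: w.
  rewrite !in_itv/= => /andP[w20 w2X] /andP[w10 w1T].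
  have : (w.1, w.2) \in K by apply: inK; rewrite !ltW.
  rewrite -surjective_pairing => /maxf; rewrite -/M /separable/=; lra.
have xm : 0 < x < m by rewrite x0 (lt_le_trans x1).
have := sub _ _ _ _ _ _ _ DcM Db Dg Ddg cdc cdb cddg t x t0 xm touch near_u.
apply/negP; rewrite -ltNge /F ger0_norm//.
have uE : u (t, x) = separable c b g (t, x) + M by rewrite /M; ring.
have pw0 := powR_ge0 (b t * dg x) gamma.
have u0 : 0 < u (t, x) by rewrite uE ltr_wpDl.
have : 0 <= u (t, x) * (b t * dg x) `^ gamma by rewrite mulr_ge0// ltW.
rewrite (mulrDr (u (t, x))) mulr1; lra.
Unshelve. all: by end_near. Qed.

(** * The plateau reaches height zero *)

(** The height [A] for which [(A / l) `^ (gamma - 2) = l ^+ 2] with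
    [l = m / 8]: replacing [(t, x, u)] by [(A ^+ 2 * t, l * x, A * u)] then
    multiplies each of [p ^ gamma * a], [p ^ (gamma - 2) * q] and [z] by [A]. *)
Definition height_scale {R : realType} (gamma m : R) : R :=
  (m / 8) `^ (gamma / (gamma - 2)).

Lemma height_scale_gt0 {R : realType} (gamma m : R) : 0 < m ->
  0 < height_scale gamma m.
Proof. by move=> m0; rewrite powR_gt0// divr_gt0. Qed.

Lemma slope_scaleE {R : realType} (gamma m : R) : 2 < gamma -> 0 < m ->
  (height_scale gamma m / (m / 8)) `^ (gamma - 2) = (m / 8) ^+ 2.
Proof.
move=> g2 m0; have g0 : gamma - 2 != 0 by rewrite subr_eq0 gt_eqF.
have l0 : 0 < m / 8 by rewrite divr_gt0.
rewrite /height_scale -[X in _ / X]powRr1 ?ltW// -powRB; last first.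
  by rewrite (gt_eqF l0) implybT.
rewrite -powRrM -powR_mulrn ?ltW//; congr (_ `^ _).
by field.
Qed.

Lemma powR_sub2 {R : realType} (gamma p : R) : 2 < gamma -> 0 <= p ->
  p `^ gamma = p `^ (gamma - 2) * p ^+ 2.
Proof.
move=> g2; rewrite le_eqVlt => /predU1P[<-|p0].
  by rewrite expr0n mulr0 powR0// gt_eqF// (lt_trans _ g2).
rewrite -(powR_mulrn 2 (ltW p0)) -powRD ?subrK//.
by rewrite (gt_eqF p0) implybT.
Qed.

Lemma is_derive_affine_comp {R : realType} (f df : R -> R) (a x0 x : R) :
  (forall y, is_derive y (1 : R) f (df y)) ->
  is_derive x (1 : R) (fun y => f (a * (y - x0))) (df (a * (x - x0)) * a).
Proof.
move=> Df.
have Da : is_derive x (1 : R) (fun y : R => a * (y - x0)) a.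
  have Dc (e : R) : is_derive x (1 : R) (fun _ => e) 0 by exact: is_derive_cst.
  have Di : is_derive x (1 : R) (fun y : R => y) 1 by exact: is_derive_id.
  case: (is_derive_mul (Dc a) (is_derive_add Di (Dc (- x0)))) => d e.
  by apply: DeriveDef; [exact: d|apply: (etrans e); ring].
exact: (@is_derive1_comp _ f (fun y => a * (y - x0)) x _ _ (Df _) Da).
Qed.

Lemma continuous_affine_comp {R : realType} (f : R -> R) (a x0 : R) :
  continuous f -> continuous (fun y => f (a * (y - x0))).
Proof.
move=> cf y; have h : {for y, continuous (fun z => a * (z - x0))}.
  apply: cvgM; first exact: cvg_cst.
  by apply: cvgB; [exact: cvg_id|exact: cvg_cst].
exact: (continuous_comp h (cf _)).
Qed.

Lemma is_derive_exprn {R : realType} (n : nat) (x : R) :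
  is_derive x (1 : R) (fun y => y ^+ n.+1) (n.+1%:R * x ^+ n).
Proof. by apply: DeriveDef; [exact: exprn_derivable|rewrite exp_derive [LHS]mulr1]. Qed.

Lemma exprn_ge_nat {R : realType} (r : R) : exists n : nat, r <= 2 ^+ n.+1.
Proof.
exists (Num.truncn r); apply: ltW; apply: (lt_trans (truncnS_gt _)).
by rewrite -natrX ltr_nat ltn_expl.
Qed.

(** Comparison of [u] with the barrier on [[0, 2 / th]] x [[0, 7 l]], where
    [1 / th = tau * A ^+ 2] is the time at which the conclusion is drawn.  The
    height of the plateau of the barrier is
      [A * (eps * (1 - th * t) ^+ 2 + N * (th * t) ^+ n.+1)]:
    the first summand makes it [eps * A] initially and zero at time [1 / th];
    the second one is [A * N] at time [1 / th], and [A * N] is arbitrarily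
    small, but [n] is so large that it exceeds [rho] at the final time
    [2 / th]. *)
Lemma subsolution_collapse {R : realType} (gamma : R) : 2 < gamma ->
  exists eps tau : R, [/\ 0 < eps, 0 < tau &
    forall (m rho : R) (u : R * R -> R), 0 < m ->
      {within `[0, +oo[ `*` `[0, m], continuous u} ->
      separable_subsolution gamma m u ->
      (forall t, 0 <= t -> u (t, 0) <= 0) ->
      (forall t x, 0 <= t -> 0 <= x <= m -> u (t, x) <= rho) ->
      (forall x, 0 <= x <= 7 * (m / 8) ->
         u (0, x) <= eps * height_scale gamma m) ->
      u (tau * height_scale gamma m ^+ 2, 5 * (m / 8)) <= 0].
Proof.
move=> g2.
have [k [kappa [eps [L [kappa0 eps0 L0 scaled]]]]] := scaled_supersolution g2.
exists eps, L^-1; split; rewrite ?invr_gt0// => m rho u m0 cu sub ux0 urho u0.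
set l := m / 8 in u0 *; have l0 : 0 < l by rewrite divr_gt0.
have mE : m = 8 * l by rewrite /l mulrC divfK.
have l7m : 7 * l <= m by rewrite mE ler_pM2r// ler_nat.
set A := height_scale gamma m in u0 *.
have A0 : 0 < A by exact: height_scale_gt0.
have slopeE : (A / l) `^ (gamma - 2) = l ^+ 2 by exact: slope_scaleE.
pose th := L / A ^+ 2.
have th0 : 0 < th by rewrite divr_gt0// exprn_gt0.
have thE : th * A ^+ 2 = L by rewrite divfK// gt_eqF// exprn_gt0.
have timeE : L^-1 * A ^+ 2 = th^-1 by rewrite /th invf_div mulrC.
rewrite timeE leNgt; apply/negP => pos.
have {rho urho} [rho rho0 urho] : exists2 r : R, 0 <= r &
    forall t x, 0 <= t -> 0 <= x <= m -> u (t, x) <= r.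
  by exists `|rho| => // t x t0 xm; apply: le_trans (ler_norm _); exact: urho.
(* [A * N] is half of the value that is to be excluded *)
pose N := u (th^-1, 5 * l) / (2 * A).
have N0 : 0 < N by rewrite divr_gt0// mulr_gt0.
have NE : A * N = u (th^-1, 5 * l) / 2 by rewrite /N; field; rewrite gt_eqF.
have [n nP] := exprn_ge_nat (rho / (A * N)).
have {nP} nP : rho <= A * (N * 2 ^+ n.+1).
  rewrite [leRHS](_ : _ = 2 ^+ n.+1 * (A * N)); last by ring.
  have AN0 : 0 < A * N by exact: mulr_gt0.
  by rewrite -(ler_pdivrMr _ _ AN0).
(* [A * kappa * profile] is at least [A * kappa / eta ^+ 2] at [s = 2] *)
pose eta := Num.min 1 (A * kappa / (rho + 1)).
have eta0 : 0 < eta by rewrite lt_min ltr01 divr_gt0// ?mulr_gt0//; lra.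
have eta1 : eta <= 1 by rewrite ge_min lexx.
have etarho : rho * eta ^+ 2 <= A * kappa.
  apply: (@le_trans _ _ ((rho + 1) * eta)).
    have : eta ^+ 2 <= eta by rewrite expr2 ler_piMl// ltW.
    by nra.
  by rewrite mulrC -ler_pdivlMr ?ge_min ?lexx ?orbT//; lra.
pose c t := A * (eps * ((1 - th * t) * (1 - th * t)) + N * (th * (t - 0)) ^+ n.+1).
pose dc t := A * (- (2 * eps * th) * (1 - th * t) +
   N * (n.+1%:R * (th * (t - 0)) ^+ n * th)).
pose b t := A * kappa * (1 + th * t).
pose g x := profile k eta (l^-1 * (x - 5 * l)).
pose dg x := dprofile k eta (l^-1 * (x - 5 * l)) * l^-1.
pose ddg x := ddprofile k eta (l^-1 * (x - 5 * l)) * l^-1 * l^-1.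
have Dcst (a x : R) : is_derive x (1 : R) (fun _ => a) 0 by exact: is_derive_cst.
have Did (x : R) : is_derive x (1 : R) (fun y => y) 1 by exact: is_derive_id.
have Dlin (a a' x : R) : is_derive x (1 : R) (fun y => a + a' * y) a'.
  case: (is_derive_add (Dcst a x) (is_derive_mul (Dcst a' x) (Did x))) => d e.
  by apply: DeriveDef; [exact: d|apply: (etrans e); ring].
have Dlin' (x : R) : is_derive x (1 : R) (fun y => 1 - th * y) (- th).
  case: (is_derive_add (Dcst 1 x) (is_derive_mul (Dcst (- th) x) (Did x))) => d e.
  have -> : (fun y => 1 - th * y) = (fun y => 1 + - th * y).
    by apply/funext => y; rewrite mulNr.
  by apply: DeriveDef; [exact: d|apply: (etrans e); ring].
have Dc t : is_derive t (1 : R) c (dc t).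
  have D1 := is_derive_mul (Dcst eps t) (is_derive_mul (Dlin' t) (Dlin' t)).
  have D2 := is_derive_mul (Dcst N t)
    (is_derive_affine_comp th 0 t (is_derive_exprn n)).
  case: (is_derive_mul (Dcst A t) (is_derive_add D1 D2)) => d e.
  by apply: DeriveDef; [exact: d|apply: (etrans e); rewrite /dc; ring].
have Db t : is_derive t (1 : R) b (A * kappa * th).
  case: (is_derive_mul (Dcst (A * kappa) t) (Dlin 1 th t)) => d e.
  by apply: DeriveDef; [exact: d|apply: (etrans e); ring].
have Dg x : is_derive x (1 : R) g (dg x).
  by apply: is_derive_affine_comp => y; exact: is_derive_profile.
have Ddg x : is_derive x (1 : R) dg (ddg x).
  have D1 := is_derive_affine_comp l^-1 (5 * l) x
    (fun y => is_derive_dprofile k y eta0).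
  case: (is_derive_mul D1 (Dcst l^-1 x)) => d e.
  by apply: DeriveDef; [exact: d|apply: (etrans e); rewrite /ddg; ring].
have cdc : continuous dc.
  move=> t; apply: cvgM; first exact: cvg_cst.
  apply: cvgD.
    apply: cvgM; first exact: cvg_cst.
    have ct : th * y @[y --> t] --> th * t by apply: cvgM; [exact: cvg_cst|exact: cvg_id].
    exact: cvgB (cvg_cst _) ct.
  apply: cvgM; first exact: cvg_cst.
  apply: cvgM; last exact: cvg_cst.
  apply: cvgM; first exact: cvg_cst.
  exact: (@continuous_affine_comp _ (fun y => y ^+ n) th 0 (@exprn_continuous R n)).
have cdb : continuous (fun _ : R => A * kappa * th) by move=> t; exact: cvg_cst.
have cddg : continuous ddg.
  move=> x; apply: cvgM; last exact: cvg_cst.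
  apply: cvgM; last exact: cvg_cst.
  exact: (@continuous_affine_comp _ (ddprofile k eta) _ _ (ddprofile_continuous eta0)).
have g0 x : 0 <= g x by exact: profile_ge0.
have c0 t : 0 <= t -> 0 <= c t.
  move=> t0; apply: mulr_ge0; first exact: ltW.
  rewrite subr0; apply: addr_ge0.
    by rewrite mulr_ge0 ?(ltW eps0)// -expr2 sqr_ge0.
  by rewrite mulr_ge0 ?(ltW N0)// exprn_ge0// mulr_ge0// ltW.
have b0 t : 0 <= t -> A * kappa <= b t.
  move=> t0; have Ak0 : 0 <= A * kappa by rewrite mulr_ge0// ltW.
  by rewrite /b ler_peMr// lerDl mulr_ge0// ltW.
have W0 t x : 0 <= t -> 0 <= separable c b g (t, x).
  move=> t0; rewrite addr_ge0 ?c0// mulr_ge0//=.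
  by apply: le_trans (b0 _ t0); rewrite mulr_ge0 ?ltW.
have cW t x : 0 <= t -> c t <= separable c b g (t, x).
  move=> t0; rewrite lerDl mulr_ge0//=.
  by apply: le_trans (b0 _ t0); rewrite mulr_ge0 ?ltW.
have bar t x : 0 <= t <= 2 / th -> 0 <= x <= 7 * l ->
    u (t, x) <= separable c b g (t, x).
  apply: (@parabolic_comparison _ gamma m (2 / th) (7 * l) u c dc b
    (fun=> A * kappa * th) g dg ddg) => //.
  - by rewrite divr_gt0.
  - by rewrite mulr_gt0.
  - apply: continuous_subspaceW cu => -[s y] [] /=; rewrite !in_itv/=.
    move=> /andP[s0 _] /andP[y0 y1]; rewrite s0 y0/=; split => //.
    exact: le_trans l7m.
  - move=> {}t {}x /andP[t0 t1] /andP[x0 x1].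
    pose s := l^-1 * (x - 5 * l).
    have s2 : s <= 2.
      rewrite /s mulrC ler_pdivrMr//; lra.
    have tht : 0 < th * t by rewrite mulr_gt0.
    have tht2 : th * t <= 2 by rewrite mulrC -ler_pdivlMr// ltW.
    pose P := kappa * (1 + th * t) * dprofile k eta s.
    have P0 : 0 <= P.
      rewrite /P mulr_ge0 ?dprofile_ge0// mulr_ge0 ?(ltW kappa0)//; lra.
    have Al0 : 0 <= A / l by apply: divr_ge0; exact: ltW.
    have pE : b t * dg x = A / l * P by rewrite /b /dg /P /s; ring.
    have p0 : 0 <= b t * dg x by rewrite pE; exact: mulr_ge0.
    split => //; first by apply: W0; exact: ltW.
    have dcs : - (2 * L * eps) <= A * dc t.
      have -> : A * dc t = - (2 * eps * L) * (1 - th * t) +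
          L * N * (n.+1%:R * (th * t) ^+ n).
        by rewrite -thE /dc subr0; ring.
      have h1 : 0 <= L * N * (n.+1%:R * (th * t) ^+ n).
        apply: mulr_ge0; first by rewrite mulr_ge0// ltW.
        by rewrite mulr_ge0// exprn_ge0// ltW.
      have h2 : 0 <= 2 * eps * L * (th * t).
        by rewrite mulr_ge0 ?(ltW tht)// mulr_ge0 ?(ltW L0)// mulr_ge0// ltW.
      lra.
    have key := scaled eta s (1 + th * t) (c t / A) (A * dc t) P.
    have {}key : 0 <= P `^ (gamma - 2) *
             (P ^+ 2 * (A * dc t + kappa * L * profile k eta s) -
              kappa * (1 + th * t) * ddprofile k eta s) +
           (c t / A + kappa * (1 + th * t) * profile k eta s).
      apply: key => //.
      - by rewrite eta0.
      - lra.
      - by rewrite divr_ge0 ?c0 ?ltW.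
    rewrite (powR_sub2 g2 p0) pE (powRM _ Al0 P0) slopeE.
    have := mulr_ge0 (ltW A0) key; congr (0 <= _).
    rewrite /separable/= /b /g /ddg -/s -thE.
    move: (P `^ (gamma - 2)) => Pw.
    by field; rewrite !gt_eqF.
  - move=> {}t {}x /andP[t0 t1] /andP[x0 x1] [tE|tE|xE|xE].
    + subst t; apply: le_trans (cW _ _ (lexx _)); rewrite /c subr0 !mulr0.
      rewrite subr0 expr0n/= mulr0 addr0 !mulr1 mulrC.
      by apply: u0; rewrite x0.
    + apply: le_trans (cW _ _ t0); apply: (@le_trans _ _ rho).
        by apply: urho => //; rewrite x0 (le_trans x1 l7m).
      apply: (le_trans nP).
      have -> : c t = A * (eps * ((1 - th * t) * (1 - th * t)) + N * 2 ^+ n.+1).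
        by rewrite /c subr0 tE [th * _]mulrC divfK ?gt_eqF.
      rewrite ler_pM2l//.
      by rewrite lerDr mulr_ge0 ?(ltW eps0)// -expr2 sqr_ge0.
    + by rewrite xE; apply: le_trans (ux0 _ t0) (W0 _ _ t0).
    + apply: (@le_trans _ _ rho).
        by apply: urho => //; rewrite x0 (le_trans x1 l7m).
      rewrite /separable/=; apply: (@le_trans _ _ (A * kappa * g x)); last first.
        by rewrite -[leLHS]add0r lerD ?c0// ler_wpM2r ?b0.
      have -> : g x = 2 ^+ k.+3 / eta ^+ 2.
        rewrite /g xE /profile /pole (_ : l^-1 * _ = 2).
          by rewrite pospow_ge0E// subrr expr0n/= add0r.
        by field; rewrite gt_eqF.
      rewrite mulrA ler_pdivlMr ?exprn_gt0//; apply: (le_trans etarho).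
      rewrite ler_peMr//; first by rewrite mulr_ge0// ltW.
      by rewrite exprn_ege1// ler1n.
have th1 : 0 <= th^-1 <= 2 / th.
  by rewrite invr_ge0 (ltW th0)/= mulrC ler_peMr ?invr_ge0 ?(ltW th0)// ler1n.
have xl : 0 <= 5 * l <= 7 * l by rewrite mulr_ge0 ?(ltW l0)//= ler_pM2r// ler_nat.
have := bar _ _ th1 xl; apply/negP; rewrite -ltNge.
have [gE _ _] := profile_le0 k eta (lexx (0 : R)).
rewrite /separable/= /g subrr mulr0 gE mulr0 addr0 /c subr0 divff ?gt_eqF//.
by rewrite subrr mulr0 mulr0 add0r expr1n mulr1 NE ltr_pdivrMr// mulr_natr mulr2n ltrDl.
Qed.

(** * The density and its second moment *)

Lemma within_continuous_comp_within {T U V : topologicalType} (A : set T)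
    (B : set U) (f : T -> U) (g : U -> V) :
  (forall x, A x -> B (f x)) ->
  {within A, continuous f} -> {within B, continuous g} ->
  {within A, continuous (g \o f)}.
Proof.
move=> fAB /subspace_continuousP cf /subspace_continuousP cg.
apply/subspace_continuousP => x Ax W nW.
have nB : within B (nbhs (f x)) (g @^-1` W) by exact: cg (fAB _ Ax) _ nW.
have := cf _ Ax _ nB; rewrite /within/= => H.
change (nbhs x (fun y => A y -> W (g (f y)))).
have S : [set y | A y -> B (f y) -> W (g (f y))] `<=` [set y | A y -> W (g (f y))].
  by move=> y h Ay; exact: h Ay (fAB _ Ay).
exact: filterS S H.
Qed.

Lemma derivable_on_continuous {R : realType} (A : set R) (f : R -> R) :
  (forall x, A x -> derivable_on A f x) -> {within A, continuous f}.
Proof.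
move=> Df; apply/subspace_continuousP => x Ax W nW.
have lin : f x + diff_quotient f x y * (y - x) @[y --> within (A `\ x) (nbhs x)] --> f x.
  rewrite -[X in _ --> X]addr0 -[X in _ --> _ + X](mulr0 (derive1_on A f x)).
  apply: cvgD; first exact: cvg_cst.
  apply: cvgM; first exact: Df.
  rewrite -(subrr x); apply: cvgB; last exact: cvg_cst.
  by apply: cvg_within.
have := lin _ nW => /= H.
change (nbhs x (fun y => A y -> W (f y))).
have {}H : nbhs x (fun y => (A `\ x) y -> W (f x + diff_quotient f x y * (y - x))) by exact: H.
have S : [set y | (A `\ x) y -> W (f x + diff_quotient f x y * (y - x))] `<=`
    [set y | A y -> W (f y)]; last exact: filterS S H.
move=> y {}H Ay; have [->|yx] := eqVneq y x; first exact: nbhs_singleton.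
rewrite -[f y](subrK (f x)) addrC -[X in _ + X](@divfK _ (y - x)) ?subr_eq0//.
by apply: H; split => //; apply/eqP.
Qed.

Lemma derive1_on_interior {R : realType} (a b : R) (f : R -> R) (x : R) :
  x \in `]a, b[ -> derivable_on `[a, b] f x ->
  is_derive x (1 : R) f (derive1_on `[a, b] f x).
Proof.
move=> xab Df; apply/is_derive1_caratheodory.
pose g z := if z == x then derive1_on `[a, b] f x else diff_quotient f x z.
exists g; split; last by rewrite /g eqxx.
  move=> z; rewrite /g; case: eqP => [->|/eqP zx]; first by rewrite !subrr mulr0.
  by rewrite /diff_quotient divfK// subr_eq0.
apply/continuous_withinNx; rewrite {2}/g eqxx => W nW.
have H : nbhs x [set z | (`[a, b] `\ x) z -> W (diff_quotient f x z)] by exact: Df _ nW.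
have S : [set z | z \in `]a, b[] `&`
    [set z | (`[a, b] `\ x) z -> W (diff_quotient f x z)] `<=`
    [set z | z != x -> W (g z)].
  move=> z [/= zab h] zx; rewrite /g (negPf zx); apply: h; split.
    exact: subset_itv_oo_cc.
  exact/eqP.
exact: filterS S (filterI (near_in_itvoo xab) H).
Qed.

(** The density [f0] is the derivative of the inverse function [h] of [u0], so
    its integral between [u0 a] and [u0 b] is [h (u0 b) - h (u0 a)]. *)
Lemma mass_integral {R : realType} (m rho : R) (u0 f0 : R -> R) :
  0 < m -> admissible m rho u0 ->
  (forall x, x \in `[0, m] -> f0 (u0 x) = (derive1_on `[0, m] u0 x)^-1) ->
  [/\ {within `[- rho, rho], continuous f0},
      {in `[- rho, rho], forall v, 0 <= f0 v},
      {in `[0, m] &, {homo u0 : x y / x < y}} &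
      forall a b, 0 <= a -> a < b -> b <= m ->
        (\int[lebesgue_measure]_(v in `[u0 a, u0 b]) (f0 v)%:E = (b - a)%:E)%E].
Proof.
move=> m0 [[Du Ddu _] [x0 [x0m minx0 d0]] u00 u0m] f0E.
set d := derive1_on `[0, m] u0 in f0E Ddu minx0 d0.
have cu : {within `[0, m], continuous u0} by exact: derivable_on_continuous.
have cd : {within `[0, m], continuous d} by exact: derivable_on_continuous.
have dpos x : x \in `[0, m] -> 0 < d x by move=> /minx0; exact: lt_le_trans.
have Du0 x : x \in `]0, m[ -> is_derive x (1 : R) u0 (d x).
  by move=> xm; apply: derive1_on_interior => //; apply: Du; exact: subset_itv_oo_cc.
have incr : {in `[0, m] &, {homo u0 : x y / x < y}}.
  apply: gtr0_derive1_lt_cc => // x xm; first by have [] := Du0 _ xm.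
  rewrite derive1E; have [_ ->] := Du0 _ xm.
  by apply: dpos; exact: subset_itv_oo_cc.
have inj : {in `[0, m] &, injective u0}.
  move=> x y xm ym e; case: (ltgtP x y) => // [/(incr _ _ xm ym)|/(incr _ _ ym xm)];
  by rewrite e ltxx.
have le_incr : {in `[0, m] &, {homo u0 : x y / x <= y}}.
  by move=> x y xm ym; rewrite le_eqVlt => /predU1P[->//|/(incr _ _ xm ym)/ltW].
have m00 : 0 \in `[0, m] by rewrite in_itv/= lexx ltW.
have mm : m \in `[0, m] by rewrite in_itv/= lexx ltW.
have u0itv x : x \in `[0, m] -> u0 x \in `[- rho, rho].
  move=> xm; rewrite in_itv/= -u00 -u0m !le_incr//; move: xm; rewrite in_itv/= => /andP[]//.
have rr : - rho < rho by rewrite -u00 -u0m incr.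
pose h v := xget 0 [set x | x \in `[0, m] /\ u0 x = v].
have hP v : v \in `[- rho, rho] -> h v \in `[0, m] /\ u0 (h v) = v.
  move=> vr; have [c cm uc] : exists2 c, c \in `[0, m] & u0 c = v.
    apply: IVT => //; first exact: ltW.
    by rewrite u00 u0m min_l ?max_r ?(ltW rr)//; move: vr; rewrite in_itv.
  by rewrite /h; case: xgetP => [y -> []//|/(_ c)]; case; split.
have hK : {in `[0, m], cancel u0 h}.
  move=> x xm; have [h1 h2] := hP _ (u0itv _ xm); exact: inj.
have ch : {within `[- rho, rho], continuous h}.
  rewrite -u00 -u0m; apply: segment_can_le_continuous => //; exact: ltW.
have f0h v : v \in `[- rho, rho] -> f0 v = (d (h v))^-1.
  by move=> /hP[h1 h2]; rewrite -f0E// h2.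
have cf0 : {within `[- rho, rho], continuous f0}.
  have cdh : {within `[- rho, rho], continuous (d \o h)}.
    apply: (within_continuous_comp_within _ ch cd) => v /= /hP[].
    by [].
  apply/subspace_continuousP => v vr.
  have cinv : ((d \o h) w)^-1 @[w --> within `[- rho, rho] (nbhs v)] --> (d (h v))^-1.
    apply: cvgV; first by rewrite gt_eqF// dpos//; have [] := hP _ vr.
    by move/subspace_continuousP: cdh; exact.
  suff : f0 w @[w --> within `[- rho, rho] (nbhs v)] --> f0 v by [].
  rewrite (f0h v vr); apply: cvg_trans cinv.
  by apply: fmap_within_eq => w /[!inE]/= wr; rewrite f0h.
split => //.
  by move=> v vr; rewrite f0h// invr_ge0 ltW// dpos//; have [] := hP _ vr.
move=> a b a0 ab bm.
have am : a \in `[0, m] by rewrite in_itv/= a0 (le_trans (ltW ab)).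
have bm' : b \in `[0, m] by rewrite in_itv/= bm (le_trans a0 (ltW ab)).
have sub : `[u0 a, u0 b] `<=` `[- rho, rho].
  apply: subset_itv; rewrite bnd_simp.
    by have := u0itv _ am; rewrite in_itv/= => /andP[].
  by have := u0itv _ bm'; rewrite in_itv/= => /andP[].
have uab : u0 a < u0 b by exact: incr.
have chab : {within `[u0 a, u0 b], continuous h} by exact: continuous_subspaceW ch.
have Dh v : v \in `]u0 a, u0 b[ -> is_derive v (1 : R) h (f0 v).
  move=> vab; have vr : v \in `[- rho, rho] by apply: sub; exact: subset_itv_oo_cc.
  have [hm uh] := hP _ vr.
  have h0m : h v \in `]0, m[.
    have /andP[v1 v2] : u0 a < u0 (h v) < u0 b by move: vab; rewrite uh in_itv.
    move: (hm); rewrite !in_itv/= => /andP[h0 h1].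
    rewrite !lt_neqAle h0 h1 !andbT; apply/andP; split; apply/eqP => e.
      by move: v1; rewrite -e ltNge le_incr// in_itv/= lexx ltW.
    by move: v2; rewrite e ltNge le_incr.
  rewrite f0h// -[X in is_derive X]uh; apply: is_derive_inverse.
  - have nI := near_in_itvoo h0m.
    by apply: filterS nI => y ym; apply: hK; exact: subset_itv_oo_cc.
  - apply: filterS (near_in_itvoo h0m) => y ym.
    apply: differentiable_continuous; apply/derivable1_diffP.
    by have [] := Du0 _ ym.
  - exact: Du0.
  - by rewrite gt_eqF// dpos.
rewrite (@continuous_FTC2 _ f0 h)//.
- by rewrite !hK// EFinB.
- exact: continuous_subspaceW cf0.
- have [_ c1 c2] := (continuous_within_itvP _ uab).1 chab.
  by split => // v /Dh[].
- by move=> v /Dh[_ e]; rewrite derive1E e.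
Qed.

(** Chebyshev's inequality: the mass [b - a] sits at speeds at least [c]. *)
Lemma second_moment_ge {R : realType} (m rho : R) (u0 f0 : R -> R) (a b c : R) :
  0 < m -> admissible m rho u0 ->
  (forall x, x \in `[0, m] -> f0 (u0 x) = (derive1_on `[0, m] u0 x)^-1) ->
  0 <= a -> a < b -> b <= m -> 0 <= c ->
  (forall v, v \in `[u0 a, u0 b] -> c <= `|v|) ->
  c ^+ 2 * (b - a) <=
    \int[lebesgue_measure]_(v in `[- rho, rho]) (`|v| ^+ 2 * f0 v).
Proof.
move=> m0 adm f0E a0 ab bm c0 cv.
have [cf0 f00 incr mass] := mass_integral m0 adm f0E.
have [_ _ u00 u0m] := adm.
have le_incr : {in `[0, m] &, {homo u0 : x y / x <= y}}.
  by move=> x y xm ym; rewrite le_eqVlt => /predU1P[->//|/(incr _ _ xm ym)/ltW].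
have inm x : 0 <= x -> x <= m -> x \in `[0, m] by rewrite in_itv/= => -> ->.
have sub : `[u0 a, u0 b] `<=` `[- rho, rho].
  apply: subset_itv; rewrite bnd_simp -?u00 -?u0m; apply: le_incr => //;
  by apply: inm; lra.
pose G v := `|v| ^+ 2 * f0 v.
have cG : {within `[- rho, rho], continuous G}.
  have cn : continuous (fun v : R => `|v| ^+ 2).
    by move=> v; exact: (continuous_comp (@norm_continuous _ R v) (@exprn_continuous R 2 _)).
  move=> v; apply: cvgM; last exact: cf0.
  exact: (@continuous_subspaceT _ _ `[- rho, rho]%classic _ cn).
have iG : lebesgue_measure.-integrable `[- rho, rho] (EFin \o G).
  by apply: continuous_compact_integrable => //; exact: segment_compact.
have if0 : lebesgue_measure.-integrable `[u0 a, u0 b] (EFin \o f0).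
  apply: continuous_compact_integrable; first exact: segment_compact.
  exact: continuous_subspaceW cf0.
have f0ab v : v \in `[u0 a, u0 b] -> 0 <= f0 v by move=> /sub; exact: f00.
rewrite -lee_fin /Rintegral fineK; last exact: integrable_fin_num.
apply: (@le_trans _ _ (\int[lebesgue_measure]_(v in `[u0 a, u0 b]) (G v)%:E)%E); last first.
  apply: ge0_subset_integral => //; first exact: measurable_int iG.
  by move=> v vr; rewrite lee_fin mulr_ge0 ?exprn_ge0//; exact: f00.
have E : ((c ^+ 2 * (b - a))%:E =
    \int[lebesgue_measure]_(v in `[u0 a, u0 b]) ((c ^+ 2)%:E * (f0 v)%:E))%E.
  rewrite EFinM -(mass _ _ a0 ab bm) ge0_integralZl_EFin ?sqr_ge0//.
  exact: measurable_int if0.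
rewrite E.
apply: ge0_le_integral => //.
- by move=> v vab; rewrite -EFinM lee_fin mulr_ge0 ?sqr_ge0//; exact: f0ab.
- by apply: measurable_funeM; exact: measurable_int if0.
- apply: measurable_funS (measurable_int _ iG) => //.
- move=> v vab; rewrite -EFinM lee_fin ler_wpM2r//; first exact: f0ab.
  by rewrite lerXn2r ?nnegrE//; exact: cv.
Qed.

(** The factor in front of [m `^ (3 * gamma / 2)] is the constant [B] of the
    theorem: it is the one for which equality holds in the hypothesis, with
    [delta = 0], when the second moment is [(eps * A) ^+ 2 * (m / 8)]. *)
Lemma energy_scaleE {R : realType} (gamma eps m : R) : 2 < gamma -> 0 < eps -> 0 < m ->
  m * ((eps * height_scale gamma m) ^+ 2 * (m / 8)) `^ ((gamma - 2) / 2) =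
  (eps ^+ 2) `^ ((gamma - 2) / 2) * 8^-1 `^ (3 * gamma / 2 - 1) * m `^ (3 * gamma / 2).
Proof.
move=> g2 eps0 m0; have g0 : gamma - 2 != 0 by rewrite subr_eq0 gt_eqF.
have l0 : 0 < m / 8 by rewrite divr_gt0.
have E : (eps * height_scale gamma m) ^+ 2 * (m / 8) =
    eps ^+ 2 * (m / 8) `^ (gamma / (gamma - 2) * 2 + 1).
  rewrite exprMn -[LHS]mulrA; congr (_ * _).
  rewrite powRD ?(gt_eqF l0) ?implybT// powRr1 ?(ltW l0)// powRrM.
  by rewrite (powR_mulrn 2 (powR_ge0 _ _)).
rewrite E powRM ?sqr_ge0 ?powR_ge0// -powRrM.
have -> : (gamma / (gamma - 2) * 2 + 1) * ((gamma - 2) / 2) = 3 * gamma / 2 - 1 by field.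
rewrite (powRM _ (ltW m0)) ?invr_ge0//.
rewrite -(mulr_powRB1 (ltW m0) (p := 3 * gamma / 2)); last by lra.
by ring.
Qed.

(** The hypothesis of the theorem says that the second moment is below the
    critical value of [energy_scaleE]. *)
Lemma concentration_lt {R : realType} (gamma eps m delta I : R) :
  2 < gamma -> 0 < eps -> 0 < m -> 0 < delta ->
  m - (eps ^+ 2) `^ ((gamma - 2) / 2) * 8^-1 `^ (3 * gamma / 2 - 1) *
    (m `^ (3 * gamma / 2) / I `^ ((gamma - 2) / 2)) <= - delta ->
  I < (eps * height_scale gamma m) ^+ 2 * (m / 8).
Proof.
move=> g2 eps0 m0 delta0; rewrite ltNge; apply: contraPN => JI; apply/negP.
have A0 := height_scale_gt0 gamma m0.
have J0 : 0 < (eps * height_scale gamma m) ^+ 2 * (m / 8).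
  by apply: mulr_gt0; [rewrite exprn_gt0// mulr_gt0|rewrite divr_gt0].
have I0 := lt_le_trans J0 JI.
have e0 : 0 <= (gamma - 2) / 2 by lra.
rewrite mulrA -energy_scaleE// -ltNge.
move: (_ ^+ 2 * _) J0 JI => J J0 JI.
have JIe : J `^ ((gamma - 2) / 2) <= I `^ ((gamma - 2) / 2).
  by apply: ge0_ler_powR; rewrite ?nnegrE// ltW.
apply: (@lt_le_trans _ _ 0); first by rewrite oppr_lt0.
rewrite subr_ge0 -mulrA ler_piMr ?(ltW m0)//.
by rewrite ler_pdivrMr ?mul1r// powR_gt0.
Qed.

Lemma strip_subset {R : realType} (m : R) :
  `[0, +oo[ `*` `[0, m] `<=` Omega m `|` parabolic_boundary m.
Proof.
move=> [t x] [] /=; rewrite !in_itv/= andbT => t0 /andP[x0 xm].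
have [->|tn] := eqVneq t 0.
  by right; left; split => //=; rewrite in_itv/= x0.
have [->|xn] := eqVneq x 0; first by right; right; split; [rewrite /= in_itv/= t0|left].
have [->|xn'] := eqVneq x m; first by right; right; split; [rewrite /= in_itv/= t0|right].
have t0' : 0 < t by rewrite lt_neqAle eq_sym tn.
have x0' : 0 < x by rewrite lt_neqAle eq_sym xn.
have xm' : x < m by rewrite lt_neqAle xn'.
by left; split; rewrite /= in_itv/= ?t0' ?x0'.
Qed.

(** * Formation of the plateau *)

Theorem proposition3p17 (R : realType) (gamma : R) (hgamma : 2 < gamma) :
  exists2 B : R, 0 < B &
    forall (m rho : R) (u0 f0 : R -> R) (u : R * R -> R),
      0 < m -> 0 < rho ->
      admissible m rho u0 ->
      (forall x, x \in `[0, m] -> f0 (u0 x) = (derive1_on `[0, m] u0 x)^-1) ->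
      solves_problem gamma m rho u0 u ->
      forall delta : R, 0 < delta ->
        m - B * (m `^ (3 * gamma / 2) /
          (\int[lebesgue_measure]_(v in `[- rho, rho]) (`|v| ^+ 2 * f0 v))
             `^ ((gamma - 2) / 2)) <= - delta ->
        ~ (forall t : R, 0 <= t -> x_p m u t = 0%E).
Proof.
have [eps [tau [eps0 tau0 collapse]]] := subsolution_collapse hgamma.
exists ((eps ^+ 2) `^ ((gamma - 2) / 2) * 8^-1 `^ (3 * gamma / 2 - 1)).
  by rewrite mulr_gt0// powR_gt0// ?exprn_gt0// invr_gt0.
move=> m rho u0 f0 u m0 rho0 adm f0E sol delta delta0 conc no_flat.
have {delta delta0 conc} conc := concentration_lt hgamma eps0 m0 delta0 conc.
have [cu visc lat u_init mono] := sol.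
have [_ _ u00 u0m] := adm.
have [_ _ incr _] := mass_integral m0 adm f0E.
set l := m / 8 in conc collapse *.
have l0 : 0 < l by rewrite divr_gt0.
have mE : m = 8 * l by rewrite /l mulrC divfK.
set A := height_scale gamma m in conc.
have A0 : 0 < A by exact: height_scale_gt0.
have eA0 : 0 <= eps * A by rewrite mulr_ge0// ltW.
have le_incr : {in `[0, m] &, {homo u0 : x y / x <= y}}.
  by move=> x y xm ym; rewrite le_eqVlt => /predU1P[->//|/(incr _ _ xm ym)/ltW].
have inm x : 0 <= x -> x <= m -> x \in `[0, m] by rewrite in_itv/= => -> ->.
have in0 : 0 \in `[0, m] by apply: inm => //; exact: ltW.
have inM : m \in `[0, m] by apply: inm => //; exact: ltW.
have high : u0 (7 * l) <= eps * A.
  rewrite leNgt; apply/negP => h; move: conc; apply/negP; rewrite -leNgt.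
  rewrite [l in leLHS](_ : l = m - 7 * l); last by rewrite mE; ring.
  apply: (second_moment_ge m0 adm f0E) => //; try lra.
  move=> v; rewrite in_itv/= => /andP[v1 _].
  by rewrite (le_trans _ (ler_norm v))// (le_trans (ltW h)).
have low : - (eps * A) <= u0 l.
  rewrite leNgt; apply/negP => h; move: conc; apply/negP; rewrite -leNgt.
  rewrite [l in leLHS](_ : l = l - 0); last by rewrite subr0.
  apply: (second_moment_ge m0 adm f0E) => //; try lra.
  move=> v; rewrite in_itv/= => /andP[_ v1].
  by rewrite -normrN (le_trans _ (ler_norm _))// lerNr (le_trans v1)// ltW.
have cstrip : {within `[0, +oo[ `*` `[0, m], continuous u}.
  exact: continuous_subspaceW (@strip_subset _ m) cu.
have u_left t : 0 <= t -> u (t, 0) = - rho.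
  by rewrite le_eqVlt => /predU1P[<-|/lat[]//]; rewrite u_init.
have u_right t : 0 <= t -> u (t, m) = rho.
  by rewrite le_eqVlt => /predU1P[<-|/lat[]//]; rewrite u_init.
pose T := tau * A ^+ 2.
have T0 : 0 <= T by rewrite mulr_ge0 ?sqr_ge0// ltW.
have upper : u (T, 5 * l) <= 0.
  apply: (collapse m rho u) => //.
  - exact: viscosity_separable_subsolution.
  - by move=> t t0; rewrite u_left// oppr_le0 ltW.
  - move=> t x t0 /andP[x0 xm]; rewrite -(u_right t t0); apply: mono => //; exact: inm.
  - move=> x /andP[x0 xl]; rewrite u_init; last by apply: inm; rewrite -?/l in xl *; lra.
    by apply: le_trans high; apply: le_incr => //; apply: inm; rewrite -?/l in xl *; lra.
have crefl : {within `[0, +oo[ `*` `[0, m],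
    continuous (u \o (fun w : R * R => (w.1, m - w.2)))}.
  apply: (within_continuous_comp_within _ _ cstrip).
    move=> [t x] [/= t0 xm]; split => //=.
    by move: xm; rewrite !in_itv/= => /andP[x0 xm]; apply/andP; split; lra.
  apply: continuous_subspaceT => -[t x].
  have h1 : z.1 @[z --> (t, x)] --> t by exact: cvg_fst.
  have h2 : m - z.2 @[z --> (t, x)] --> m - x.
    by apply: cvgB; [exact: cvg_cst|exact: cvg_snd].
  exact: (cvg_pair h1 h2).
have lower : 0 <= u (T, 3 * l).
  have -> : 3 * l = m - 5 * l by rewrite mE; ring.
  rewrite -oppr_le0.
  apply: (collapse m rho (fun w => - u (w.1, m - w.2))) => //.
  - by move=> w; apply: cvgN; exact: crefl.
  - exact: viscosity_separable_subsolution_reflect.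
  - by move=> t t0 /=; rewrite subr0 u_right// oppr_le0 ltW.
  - move=> t x t0 /andP[x0 xm] /=; rewrite lerNl -(u_left t t0).
    by apply: mono => //; [apply: inm; lra|lra].
  - move=> x /andP[x0 xl] /=; rewrite u_init; last by apply: inm; rewrite -?/l in xl *; lra.
    rewrite lerNl; apply: (le_trans low).
    by apply: le_incr => //; [apply: inm|apply: inm|]; rewrite -?/l in xl *; lra.
pose S := [set x : R | x \in `[0, m] /\ u (T, x) = 0].
have S_itv : is_interval S.
  move=> x y [xm ux] [ym uy] z /andP[xz zy].
  move: (xm) (ym); rewrite !in_itv/= => /andP[x0 _] /andP[_ ym'].
  have zm : z \in `[0, m] by apply: inm; [exact: le_trans xz|exact: le_trans ym'].
  split => //; apply/eqP; rewrite eq_le -{1}uy -ux.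
  by rewrite !mono.
pose J : set R := `[3 * l, 5 * l]%classic.
have flat : J `<=` S.
  move=> x; rewrite /J/= in_itv/= => /andP[x3 x5].
  have xm : x \in `[0, m] by apply: inm; lra.
  split => //; apply/eqP; rewrite eq_le; apply/andP; split.
    by apply: le_trans upper; apply: mono => //; apply: inm; lra.
  by apply: (le_trans lower); apply: mono => //; apply: inm; lra.
have : (lebesgue_measure J <= lebesgue_measure S)%E.
  have mS : measurable S by exact: is_interval_measurable.
  have mJ : measurable J by exact: measurable_itv.
  by apply: le_measure; rewrite ?inE.
have -> : lebesgue_measure S = 0%E by exact: no_flat T T0.
rewrite /J lebesgue_measure_itv/= lte_fin ltr_pM2r// ltr_nat/= -EFinB lee_fin.
lra.
Qed.
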